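(* Let $M=(\mathcal P,\mathcal R,m,f)$ be a DP problem and $G_\theta$ a finite graph approximating the dependency graph of $M$, with strongly connected components (node sets) $C_1,\dots,C_n$. The processor that maps $M$ to $\{(\{\rho\in\mathcal P\mid\theta(\rho)\in C_i\},\mathcal R,m,f)\mid 1\le i\le n\}$ is both sound and complete.
   Context: Base formalism. Sorts $\mathcal S$; simple types are sorts and $\sigma\to\tau$; base type = sort. Disjoint typed sets $\mathcal F$ (function symbols), $\mathcal V$ (variables), infinitely many of every type, and meta-variables $\mathcal M$ with declarations $[\sigma_1\times..\times\sigma_k]\to\tau$, $k=\mathrm{ar}(Z)$. Meta-terms: variables, function symbols, typed application (left-assoc.), $\lambda x.s$, $Z\langle s_1..s_e\rangle$ ($e\ge\mathrm{ar}(Z)$, argument types as declared); modulo $\alpha$; terms have no meta-variables; $FV,FMV$; $\unrhd$ subterm (through application and abstraction), $\rhd$ strict. Patterns: $Z\langle x_1..x_k\rangle$ (distinct vars, $k=\mathrm{ar}(Z)$), $\lambda x.\ell$, $a\,\ell_1\cdots\ell_n$, $a\in\mathcal F\cup\mathcal V$; fully extended: each bound $y$ of $\lambda y.\ell'$ is an argument of all meta-variable occurrences in $\ell'$; linear: meta-variables occur once. Substitutions $\gamma$: variables to terms, $Z$ (arity $k$) to $\lambda y_1..y_k.u$; $\gamma(Z)\approx_e\lambda x_1..x_e.s$ means $\gamma(Z)=\lambda x_1..x_e.s$ or $\gamma(Z)=\lambda x_1..x_i.t$, $k\le i<e$, $t$ not an abstraction, $s=t\,x_{i+1}\cdots x_e$;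 application is capture-avoiding with $Z\langle s_1..s_e\rangle\gamma=t[x_1:=s_1\gamma,..,x_e:=s_e\gamma]$ for $\gamma(Z)\approx_e\lambda x_1..x_e.t$. Rules $\ell\Rightarrow r$: closed meta-terms of equal type, $\ell$ a pattern $f\,\ell_1\cdots\ell_n$, $f\in\mathcal F$, $FMV(r)\subseteq FMV(\ell)$; $\to_S$ for a rule set $S$ is the smallest context-closed (also under $\lambda$) relation on terms containing $\ell\delta\to r\delta$ and $(\lambda x.s)t\to s[x:=t]$. Defined symbols $\mathcal D$; arity function $\mathrm{ar}$ with $\mathrm{ar}(f)\le$ number of argument types of $f$. A fixed quasi-ordering $\succeq$ on $\mathcal S$ with well-founded strict part $\succ$ gives $\iota\succeq_+\sigma$ (iff $\iota\succeq\kappa$ and all $\iota\succ_-\sigma_i$) and $\iota\succ_-\sigma$ (iff $\iota\succ\kappa$ and all $\iota\succeq_+\sigma_i$) for $\sigma=\sigma_1\to..\to\sigma_m\to\kappa$, and $\mathrm{Acc}(f)=\{i\mid\iota\succeq_+\sigma_i\}$ for $f:\sigma_1\to..\to\sigma_m\to\iota$. DPs. $\mathcal F^\sharp=\mathcal F\uplus\{f^\sharp\mid f\in\mathcal D\}$; $s^\sharp=f^\sharp s_1\cdots s_k$ if $s=f\,s_1\cdots s_k$, $f\in\mathcal D$, $k=\mathrm{ar}(f)$, else $s$. $\gamma$ respects a set $A$ of conditions $Z:i$ if for each, writing $\gamma(Z)=\lambda x_1..x_n.t$ ($t$ not abstraction), $i>n$ or $x_i\in FV(t)$. A DP $\ell\Rrightarrow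 p\ (A)$: $\ell$ closed pattern $f\,\ell_1\cdots\ell_n$, $f\in\mathcal F^\sharp$, $n\ge\mathrm{ar}(f)$; collapsing if $p=Z\langle s_1..s_e\rangle t_1\cdots t_j$. $s\unrhd_At$: $s=t\,s_1\cdots s_n$; or $s=\lambda x.u$, $u\unrhd_At$; or $s=(\lambda x.u)s_0\cdots s_n$, $u[x:=s_0]s_1\cdots s_n\unrhd_At$; or $s=a\,s_1\cdots s_n$ ($a$ abstraction, meta-variable application, or in $\mathcal V\cup\mathcal F$), $s_i\unrhd_At$; or $s=Z\langle t_1..t_e\rangle s_1\cdots s_n$, $t_i\unrhd_At$ with $(Z:i)\in A$. Chains. A $(\mathcal P,\mathcal R)$-chain is an infinite sequence $[(\rho_i,s_i,t_i)]$, $\rho_i\in\mathcal P\cup\{\mathtt{beta}\}$, with: (1) if $\rho_i=\mathtt{beta}$, $s_i=(\lambda x.u)v\,w_1\cdots w_n$ and either $n>0$, $t_i=u[x:=v]w_1\cdots w_n$, or $n=0$, $t_i=q^\sharp[x:=v]$ with $u\unrhd q$, $x\in FV(q)$, $q\ne x$; (2) if $\rho_i=\ell_i\Rrightarrow p_i\ (A_i)$, there is $\gamma$ on $FMV(\ell_i)\cup FMV(p_i)\cup FV(p_i)$ mapping $FV(p_i)$ to fresh variables, respecting $A_i$, $s_i=\ell_i\gamma$, and $t_i=p_i\gamma$ if $p_i$ is an application or symbol $f^\sharp$, while if $p_i=Z\langle u_1..u_e\rangle$ with $\gamma(Z)\approx_e\lambda x_1..x_e.w$, $t_i=v^\sharp[x_1:=u_1\gamma,..]$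 for a non-variable subterm $v$ of $w$ containing some $x_j$ free; (3) $t_i=s_{i+1}$, or $t_i=f\,u_1\cdots u_n$, $s_{i+1}=f\,w_1\cdots w_n$, $f\in\mathcal F^\sharp$, $u_j\to^*_{\mathcal R}w_j$. Minimal: all strict subterms of all $t_i$ terminate under $\to_{\mathcal R}$. Formative: whenever $\rho_{i+1}=\ell\Rrightarrow p\ (A)\in\mathcal P$, $t_i\to^*_{\mathcal R}s_{i+1}$ is $\ell$-formative, where $s\to^*_{\mathcal R}\ell\gamma$ is $\ell$-formative if (inductively): $\ell$ is not a fully extended linear pattern; or $\ell=Z\langle x_1..x_k\rangle$, $s=\ell\gamma$; or $s=a\,s_1\cdots s_n$, $\ell=a\,\ell_1\cdots\ell_n$, $a\in\mathcal F^\sharp\cup\mathcal V$, each $s_i\to^*\ell_i\gamma$ $\ell_i$-formative; or $s=\lambda x.s'$, $\ell=\lambda x.\ell'$, $s'\to^*\ell'\gamma$ $\ell'$-formative; or $s=(\lambda x.u)v\,w_1\cdots w_n$, $u[x:=v]w_1\cdots w_n\to^*\ell\gamma$ $\ell$-formative; or $\ell$ is not a meta-variable application and there are $\delta$, $\ell'\Rightarrow r'\in\mathcal R$, meta-variables $Z_1..Z_n$ with $s\to^*(\ell'Z_1\cdots Z_n)\delta$ $\ell'$-formative and $(r'Z_1\cdots Z_n)\delta\to^*\ell\gamma$ $\ell$-formative. Computable: for a rule set $S$, RC-sets for $\to_S$ (sets $I$ of base-type terms, terminating, closed under $\to_S$, containing each term $x\,s_1\cdots s_n$ or $(\lambda x.u)s_0\cdots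 s_n$ whose reducts are all in $I$), $I$-computability ($s:\iota\in\mathcal S$ iff $s\in I$; $s:\sigma\to\tau$ iff $s\,t$ computable for all computable $t$), $f\,s_1\cdots s_m\to_{\mathrm{acc},I}s_i\,t_1\cdots t_n$ (base types, $i\in\mathrm{Acc}(f)$, $t_j$ computable); $C_S$ is an RC-set with $C_S=\{s:\iota\mid s$ terminating under $\to_S\cup\to_{\mathrm{acc},C_S}$ and if $s\to^*_Sf\,s_1\cdots s_m:\iota$ then $s_i$ is $C_S$-computable for $i\in\mathrm{Acc}(f)\}$. The chain is $S$-computable if $\to_S\supseteq\to_{\mathcal R}$ and for all $i$ there is $\gamma_i$ with $\rho_i=\ell_i\Rrightarrow p_i\ (A_i)$, $s_i=\ell_i\gamma_i$, $t_i=p_i\gamma_i$, and $(\lambda x_1..x_n.v)\gamma_i$ $C_S$-computable whenever $p_i\unrhd_Bv$, $\gamma_i$ respects $B$, $FV(v)=\{x_1..x_n\}$. DP problems. A DP problem is $(\mathcal P,\mathcal R,m,f)$: $\mathcal P$ a set of DPs, $\mathcal R$ a set of rules, $m\in\{\mathtt{minimal},\mathtt{arbitrary}\}\cup\{\mathtt{computable}_S\mid S$ a rule set$\}$, $f\in\{\mathtt{formative},\mathtt{all}\}$. It is finite if there is no $(\mathcal P,\mathcal R)$-chain that is $S$-computable if $m=\mathtt{computable}_S$, minimal if $m=\mathtt{minimal}$, and formative if $f=\mathtt{formative}$; infinite if not finite or $\to_{\mathcal R}$ is non-terminating. A processor maps a DP problem to NO or to a set of DP problems; sound: $M$ finite whenever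 $\mathrm{Proc}(M)\ne$ NO and all its elements are finite; complete: $M$ infinite whenever $\mathrm{Proc}(M)=$ NO or contains an infinite element. Dependency graph of $(\mathcal P,\mathcal R,m,f)$: nodes are elements of $\mathcal P$; edge from $\ell_1\Rrightarrow p_1\ (A_1)$ to $\ell_2\Rrightarrow p_2\ (A_2)$ iff $p_1=Z\langle s_1..s_e\rangle t_1\cdots t_n$ ($e,n\ge0$), or $p_1=f\,s_1\cdots s_n$, $\ell_2=f\,u_1\cdots u_n$ and there are substitutions $\gamma,\delta$ respecting $A_1,A_2$ and mapping variables to variables with $s_i\gamma\to^*_{\mathcal R}u_i\delta$ for all $i$. A finite graph $G_\theta$ approximates it if $\theta$ maps nodes of the dependency graph to nodes of $G_\theta$ such that each edge $\rho_1\to\rho_2$ yields an edge $\theta(\rho_1)\to\theta(\rho_2)$.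
   Formalization: Dependency pairs whose right-hand side p is headed by a beta-redex, p = (λx.u) v w_1…w_n, are excluded; with them soundness fails, e.g. f♯ X ⇛ (λx.g x) X and g♯ X ⇛ (λx.f x) X have an infinite chain but no graph edges. *)

(* Defs.v *)
From Stdlib Require Import List Relations.
From HB Require Import structures.
From mathcomp Require Import all_boot.

Set Implicit Arguments.
Unset Strict Implicit.
Unset Printing Implicit Defensive.

Inductive ty (S : Type) : Type :=
| Base of S
| Arr of ty S & ty S.

Definition arrows (S : Type) (ss : seq (ty S)) (t : ty S) : ty S :=
  foldr (@Arr S) t ss.

Fixpoint ty_args (S : Type) (t : ty S) : seq (ty S) :=
  if t is Arr a b then a :: ty_args b else [::].

Fixpoint ty_sort (S : Type) (t : ty S) : S :=
  match t with Base i => i | Arr _ b => ty_sort b end.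

(* A meta-variable [Z] is declared as [margs Z] -> [mres Z]; its arity is
   [size (margs Z)], while [mres Z] may itself be an arrow type. *)
Record signature := Signature {
  bsort : Type;
  sort_ge : bsort -> bsort -> Prop;
  sort_ge_refl : forall i, sort_ge i i;
  sort_ge_trans : forall i j k, sort_ge i j -> sort_ge j k -> sort_ge i k;
  sort_gt_wf : well_founded (fun j i => sort_ge i j /\ ~ sort_ge j i);
  funsym : Type;
  fty : funsym -> ty bsort;
  defined : pred funsym;
  ar : funsym -> nat;
  ar_le : forall f, ar f <= size (ty_args (fty f));
  var : eqType;
  vty : var -> ty bsort;
  var_infinite : forall (t : ty bsort) (xs : seq var),
    exists x, vty x = t /\ x \notin xs;
  mvar : eqType;
  margs : mvar -> seq (ty bsort);
  mres : mvar -> ty bsort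
}.

Section Framework.

Variable sg : signature.
Local Notation sort := (bsort sg).
Local Notation ty := (ty (Defs.bsort sg)).
Local Notation var := (var sg).
Local Notation mvar := (mvar sg).

Definition sort_gt (i j : sort) : Prop := sort_ge i j /\ ~ sort_ge j i.

Fixpoint ge_plus (i : sort) (t : ty) : Prop :=
  match t with
  | Base k => sort_ge i k
  | Arr a b => gt_minus i a /\ ge_plus i b
  end
with gt_minus (i : sort) (t : ty) : Prop :=
  match t with
  | Base k => sort_gt i k
  | Arr a b => ge_plus i a /\ gt_minus i b
  end.

Definition mar (Z : mvar) : nat := size (margs Z).
Definition mty (Z : mvar) : ty := arrows (margs Z) (mres Z).

Inductive fsharp : Type :=
| Plain of funsym sg
| Marked of {f : funsym sg | defined f}.

Definition unmark (f : fsharp) : funsym sg :=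
  match f with Plain g => g | Marked g => sval g end.
Definition fsty (f : fsharp) : ty := fty (unmark f).
Definition fsar (f : fsharp) : nat := ar (unmark f).

(* Locally nameless: variables bound inside the term are de Bruijn indices
   [Bound], free variables are elements of [var].  Meta-terms of the paper are
   the locally closed, typable elements, over the signature extended with the
   marked symbols. *)
Inductive mterm : Type :=
| Bound of nat
| Var of var
| Fun of fsharp
| App of mterm & mterm
| Lam of ty & mterm
| Meta of mvar & seq mterm.

Definition apps (s : mterm) (ts : seq mterm) : mterm := foldl App s ts.

Fixpoint mhead (s : mterm) : mterm := if s is App u _ then mhead u else s.
Fixpoint spine_args (s : mterm) : seq mterm :=
  if s is App u v then rcons (spine_args u) v else [::].

(* [G] types the dangling de Bruijn indices. *)
Inductive has_type (G : seq ty) : mterm -> ty -> Prop :=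
| T_Bound i a : onth G i = Some a -> has_type G (Bound i) a
| T_Var x : has_type G (Var x) (vty x)
| T_Fun f : has_type G (Fun f) (fsty f)
| T_App s t a b : has_type G s (Arr a b) -> has_type G t a ->
    has_type G (App s t) b
| T_Lam a s b : has_type (a :: G) s b -> has_type G (Lam a s) (Arr a b)
| T_Meta Z ts ss b : mar Z <= size ts -> mty Z = arrows ss b ->
    Forall2 (has_type G) ts ss -> has_type G (Meta Z ts) b.

Fixpoint fv (s : mterm) : seq var :=
  match s with
  | Bound _ | Fun _ => [::]
  | Var x => [:: x]
  | App u v => fv u ++ fv v
  | Lam _ u => fv u
  | Meta _ ts => flatten (map fv ts)
  end.

(* One entry per occurrence. *)
Fixpoint fmv (s : mterm) : seq mvar :=
  match s with
  | Bound _ | Var _ | Fun _ => [::]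
  | App u v => fmv u ++ fmv v
  | Lam _ u => fmv u
  | Meta Z ts => Z :: flatten (map fmv ts)
  end.

Fixpoint unmarked (s : mterm) : bool :=
  match s with
  | Bound _ | Var _ => true
  | Fun f => if f is Plain _ then true else false
  | App u v => unmarked u && unmarked v
  | Lam _ u => unmarked u
  | Meta _ ts => all unmarked ts
  end.

Definition is_mterm (s : mterm) : Prop := exists t, has_type [::] s t.
Definition is_closed (s : mterm) : Prop := fv s = [::].
Definition term_of (s : mterm) (t : ty) : Prop :=
  has_type [::] s t /\ fmv s = [::].
Definition is_term (s : mterm) : Prop := exists t, term_of s t.

Definition up_ren (xi : nat -> nat) (i : nat) : nat :=
  if i is j.+1 then (xi j).+1 else 0.

Fixpoint rename (xi : nat -> nat) (s : mterm) : mterm :=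
  match s with
  | Bound i => Bound (xi i)
  | Var x => Var x
  | Fun f => Fun f
  | App u v => App (rename xi u) (rename xi v)
  | Lam a u => Lam a (rename (up_ren xi) u)
  | Meta Z ts => Meta Z (map (rename xi) ts)
  end.

Definition up_inst (th : nat -> mterm) (i : nat) : mterm :=
  if i is j.+1 then rename S (th j) else Bound 0.

Fixpoint binst (th : nat -> mterm) (s : mterm) : mterm :=
  match s with
  | Bound i => th i
  | Var x => Var x
  | Fun f => Fun f
  | App u v => App (binst th u) (binst th v)
  | Lam a u => Lam a (binst (up_inst th) u)
  | Meta Z ts => Meta Z (map (binst th) ts)
  end.

(* [s[x1:=t1,..,xe:=te]] for the body [s] of [lambda x1..xe.s]; the innermost
   binder [xe] is index 0. *)
Definition inst (s : mterm) (ts : seq mterm) : mterm :=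
  binst (fun i => nth (Bound (i - size ts)) (rev ts) i) s.

Definition open (s : mterm) (x : var) : mterm := inst s [:: Var x].

Fixpoint close_at (k : nat) (x : var) (s : mterm) : mterm :=
  match s with
  | Bound i => Bound (bump k i)
  | Var y => if y == x then Bound k else Var y
  | Fun f => Fun f
  | App u v => App (close_at k x u) (close_at k x v)
  | Lam a u => Lam a (close_at k.+1 x u)
  | Meta Z ts => Meta Z (map (close_at k x) ts)
  end.

Definition abs (x : var) (s : mterm) : mterm := Lam (vty x) (close_at 0 x s).

(* The number [n] of leading abstractions, and the body [t], in
   [lambda x1..xn.t] with [t] not an abstraction. *)
Fixpoint lams (s : mterm) : nat := if s is Lam _ u then (lams u).+1 else 0.
Fixpoint unlam (s : mterm) : mterm := if s is Lam _ u then unlam u else s.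

Fixpoint bound_in (k : nat) (s : mterm) : bool :=
  match s with
  | Bound i => i == k
  | Var _ | Fun _ => false
  | App u v => bound_in k u || bound_in k v
  | Lam _ u => bound_in k.+1 u
  | Meta _ ts => has (bound_in k) ts
  end.

(* The unique [s] with [t ~_e lambda x1..xe.s]: strip [e] abstractions, or, if
   there are only [i < e] of them, strip these and apply the body to
   [x(i+1) .. xe]. *)
Fixpoint approx_body (e : nat) (t : mterm) : mterm :=
  match e, t with
  | 0, _ => t
  | e'.+1, Lam _ u => approx_body e' u
  | _, _ => apps (rename (addn e) t) (mkseq (fun j => Bound (e - j.+1)) e)
  end.

Record substitution := Substitution {
  sv : var -> mterm;
  sm : mvar -> mterm
}.

Definition wf_subst (g : substitution) : Prop :=
  (forall x, term_of (sv g x) (vty x)) /\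
  (forall Z, term_of (sm g Z) (mty Z) /\ mar Z <= lams (sm g Z)).

(* No lifting is needed below [Lam]: the values of a substitution are locally
   closed. *)
Fixpoint msubst (g : substitution) (s : mterm) : mterm :=
  match s with
  | Bound i => Bound i
  | Var x => sv g x
  | Fun f => Fun f
  | App u v => App (msubst g u) (msubst g v)
  | Lam a u => Lam a (msubst g u)
  | Meta Z ts => inst (approx_body (size ts) (sm g Z)) (map (msubst g) ts)
  end.

Definition upd_var (g : substitution) (x : var) (t : mterm) : substitution :=
  Substitution (fun y => if y == x then t else sv g y) (sm g).

(* [s[x1:=t1,..,xe:=te]] for named variables and locally closed [ti]. *)
Fixpoint vsubst (xs : seq var) (ts : seq mterm) (s : mterm) : mterm :=
  match s with
  | Bound i => Bound i
  | Var x => nth (Var x) ts (index x xs)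
  | Fun f => Fun f
  | App u v => App (vsubst xs ts u) (vsubst xs ts v)
  | Lam a u => Lam a (vsubst xs ts u)
  | Meta Z us => Meta Z (map (vsubst xs ts) us)
  end.

(* Subterms of terms.  Going below an abstraction turns the bound variable into
   a free one, whose name is chosen outside [A]; in capture-sensitive uses, [A]
   lists the names with which it must not be confused. *)
Inductive subterm (A : seq var) : mterm -> mterm -> Prop :=
| sub_refl s : subterm A s s
| sub_strict s t : strict_subterm A s t -> subterm A s t
with strict_subterm (A : seq var) : mterm -> mterm -> Prop :=
| sub_appl u v t : subterm A u t -> strict_subterm A (App u v) t
| sub_appr u v t : subterm A v t -> strict_subterm A (App u v) t
| sub_lam a u x t : vty x = a -> x \notin fv u -> x \notin A ->
    subterm A (open u x) t -> strict_subterm A (Lam a u) t.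

Definition is_variable (s : mterm) : bool :=
  match s with Bound _ | Var _ => true | _ => false end.
Definition is_symbol (s : mterm) : bool :=
  match s with Bound _ | Var _ | Fun _ => true | _ => false end.
Definition is_meta (s : mterm) : bool :=
  if s is Meta _ _ then true else false.
Definition is_app (s : mterm) : bool :=
  if s is App _ _ then true else false.

Inductive pattern : mterm -> Prop :=
| P_meta Z xs : size xs = mar Z -> all is_variable xs -> NoDup xs ->
    pattern (Meta Z xs)
| P_lam a l : pattern l -> pattern (Lam a l)
| P_apps a ls : is_symbol a -> Forall pattern ls -> pattern (apps a ls).

(* [d] is the number of abstractions crossed so far. *)
Fixpoint fully_extended_at (d : nat) (l : mterm) : Prop :=
  match l with
  | Bound _ | Var _ | Fun _ => True
  | App u v => fully_extended_at d u /\ fully_extended_at d v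
  | Lam _ u => fully_extended_at d.+1 u
  | Meta _ xs => forall i, i < d -> In (Bound i) xs
  end.

Definition fully_extended (l : mterm) : Prop := fully_extended_at 0 l.
Definition linear (l : mterm) : Prop := uniq (fmv l).

Definition is_rule (l r : mterm) : Prop :=
  (exists t, has_type [::] l t /\ has_type [::] r t) /\
  is_closed l /\ is_closed r /\ unmarked l /\ unmarked r /\
  pattern l /\ (exists f ls, l = apps (Fun (Plain f)) ls) /\
  {subset fmv r <= fmv l}.

Record rule := Rule { lhs : mterm; rhs : mterm; ruleP : is_rule lhs rhs }.
Definition rule_set := rule -> Prop.

Inductive red (R : rule_set) : mterm -> mterm -> Prop :=
| red_rule rl d : R rl -> wf_subst d ->
    red R (msubst d (lhs rl)) (msubst d (rhs rl))
| red_beta a s t : red R (App (Lam a s) t) (inst s [:: t])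
| red_appl s s' t : red R s s' -> red R (App s t) (App s' t)
| red_appr s t t' : red R t t' -> red R (App s t) (App s t')
| red_lam a s s' x : vty x = a -> x \notin fv s -> x \notin fv s' ->
    red R (open s x) (open s' x) -> red R (Lam a s) (Lam a s').

Definition reds (R : rule_set) : mterm -> mterm -> Prop :=
  clos_refl_trans mterm (red R).

Definition sn (r : mterm -> mterm -> Prop) (s : mterm) : Prop :=
  Acc (fun t u => r u t) s.

Definition terminating (R : rule_set) : Prop :=
  forall s, is_term s -> sn (red R) s.

Definition sharp (s : mterm) : mterm :=
  if mhead s is Fun (Plain f) then
    if size (spine_args s) == ar f then
      if insub f is Some g then apps (Fun (Marked g)) (spine_args s) else s
    else s
  else s.

(* [A Z i] is the condition [Z : i+1], i.e. argument positions are counted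
   from 0. *)
Definition conditions := mvar -> nat -> Prop.

Definition respects (g : substitution) (A : conditions) : Prop :=
  forall Z i, A Z i ->
    lams (sm g Z) <= i \/ bound_in (lams (sm g Z) - i.+1) (unlam (sm g Z)).

(* The right-hand side of a dependency pair is headed by a symbol or a
   meta-variable application, not by a beta-redex: beta-redexes are contracted
   when dependency pairs are generated, and the dependency graph has no edges
   for them. *)
Definition is_dp (l p : mterm) : Prop :=
  is_mterm l /\ is_mterm p /\ is_closed l /\ pattern l /\
  (exists f ls, l = apps (Fun f) ls /\ fsar f <= size ls) /\
  ~ (exists a u v ws, p = apps (App (Lam a u) v) ws).

Record dp := DP {
  dpl : mterm;
  dpr : mterm;
  dpc : conditions;
  dpP : is_dp dpl dpr
}.

Inductive beta_sub (B : conditions) : mterm -> mterm -> Prop :=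
| bs_head t ss : beta_sub B (apps t ss) t
| bs_lam a u x t : vty x = a -> x \notin fv u ->
    beta_sub B (open u x) t -> beta_sub B (Lam a u) t
| bs_beta a u s ss t : beta_sub B (apps (inst u [:: s]) ss) t ->
    beta_sub B (apps (App (Lam a u) s) ss) t
| bs_arg a ss s t : ~~ is_app a -> In s ss -> beta_sub B s t ->
    beta_sub B (apps a ss) t
| bs_meta Z ts ss i u t : onth ts i = Some u -> B Z i -> beta_sub B u t ->
    beta_sub B (apps (Meta Z ts) ss) t.

Inductive label : Type :=
| Beta
| Pair of dp.

Definition beta_step (s t : mterm) : Prop :=
  exists a u v ws, s = apps (App (Lam a u) v) ws /\
    ((ws <> [::] /\ t = apps (inst u [:: v]) ws) \/
     (ws = [::] /\ exists x q,
        vty x = a /\ x \notin fv u /\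
        subterm (x :: fv v) (open u x) q /\ x \in fv q /\ q <> Var x /\
        t = vsubst [:: x] [:: v] (sharp q))).

Definition fresh_on (g : substitution) (l p : mterm) : Prop :=
  {in fv p, forall x, exists y, sv g x = Var y /\ y \notin fv (msubst g l) /\
     {in fmv l ++ fmv p, forall Z, y \notin fv (sm g Z)}} /\
  {in fv p &, injective (sv g)}.

(* Substitutions are total; their values outside the meta-variables and
   variables of the dependency pair play no role. *)
Definition dp_step (rho : dp) (s t : mterm) : Prop :=
  exists g, wf_subst g /\ fresh_on g (dpl rho) (dpr rho) /\
    respects g (dpc rho) /\ s = msubst g (dpl rho) /\
    ((((exists u v, dpr rho = App u v) \/
       (exists f, dpr rho = Fun (Marked f))) /\ t = msubst g (dpr rho)) \/
     (exists Z us xs v,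
        dpr rho = Meta Z us /\
        map (@vty sg) xs = take (size us) (ty_args (mty Z)) /\
        size xs = size us /\ uniq xs /\
        {in xs, forall x, x \notin fv (sm g Z)} /\
        subterm (xs ++ flatten (map (fun u => fv (msubst g u)) us))
          (inst (approx_body (size us) (sm g Z)) (map Var xs)) v /\
        ~~ is_variable v /\ has (mem (fv v)) xs /\
        t = vsubst xs (map (msubst g) us) (sharp v))).

Definition chain_link (R : rule_set) (t s : mterm) : Prop :=
  t = s \/
  exists f us ws, t = apps (Fun f) us /\ s = apps (Fun f) ws /\
    Forall2 (reds R) us ws.

Record chain (P : dp -> Prop) (R : rule_set)
    (rho : nat -> label) (s t : nat -> mterm) : Prop := Chain {
  chain_terms : forall i, is_term (s i) /\ is_term (t i);
  chain_step : forall i,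
    match rho i with
    | Beta => beta_step (s i) (t i)
    | Pair r => P r /\ dp_step r (s i) (t i)
    end;
  chain_next : forall i, chain_link R (t i) (s i.+1)
}.

Definition minimal_chain (R : rule_set) (t : nat -> mterm) : Prop :=
  forall i u, strict_subterm [::] (t i) u -> sn (red R) u.

(* [formative R g l s]: the reduction from [s] to [msubst g l] is
   [l]-formative. *)
Inductive formative (R : rule_set) :
    substitution -> mterm -> mterm -> Prop :=
| form_any g l s : ~ (pattern l /\ fully_extended l /\ linear l) ->
    reds R s (msubst g l) -> formative R g l s
| form_meta g Z xs : pattern (Meta Z xs) ->
    formative R g (Meta Z xs) (msubst g (Meta Z xs))
| form_apps g a ls ss : is_symbol a -> msubst g a = a ->
    Forall2 (formative R g) ls ss -> formative R g (apps a ls) (apps a ss)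
| form_lam g a l s x : vty x = a -> x \notin fv s -> x \notin fv l ->
    x \notin fv (msubst g (Lam a l)) ->
    formative R (upd_var g x (Var x)) (open l x) (open s x) ->
    formative R g (Lam a l) (Lam a s)
| form_beta g l a u v ws : formative R g l (apps (inst u [:: v]) ws) ->
    formative R g l (apps (App (Lam a u) v) ws)
| form_rule g l s d rl Zs : ~~ is_meta l -> R rl -> wf_subst d ->
    uniq Zs -> {in Zs, forall Z, Z \notin fmv (lhs rl)} ->
    is_mterm (apps (lhs rl) [seq Meta Z [::] | Z <- Zs]) ->
    formative R d (apps (lhs rl) [seq Meta Z [::] | Z <- Zs]) s ->
    formative R g l (msubst d (apps (rhs rl) [seq Meta Z [::] | Z <- Zs])) ->
    formative R g l s.

Definition formative_chain (R : rule_set)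
    (rho : nat -> label) (s t : nat -> mterm) : Prop :=
  forall i r, rho i.+1 = Pair r ->
    exists g, wf_subst g /\ s i.+1 = msubst g (dpl r) /\
      formative R g (dpl r) (t i).

Fixpoint computable_at (I : mterm -> Prop) (a : ty) (s : mterm) : Prop :=
  match a with
  | Base k => term_of s (Base k) /\ I s
  | Arr b c => term_of s (Arr b c) /\
      forall t, computable_at I b t -> computable_at I c (App s t)
  end.

Definition computable (I : mterm -> Prop) (s : mterm) : Prop :=
  exists a, computable_at I a s.

Record rc_set (S : rule_set) (I : mterm -> Prop) : Prop := RCSet {
  rc_base : forall s, I s -> exists k, term_of s (Base k);
  rc_sn : forall s, I s -> sn (red S) s;
  rc_red : forall s t, I s -> red S s t -> I t;
  rc_neutral : forall s k, term_of s (Base k) ->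
    ((exists x ss, s = apps (Var x) ss) \/
     (exists a u v ss, s = apps (App (Lam a u) v) ss)) ->
    (forall t, red S s t -> I t) -> I s
}.

(* Accessible argument positions, counted from 0. *)
Definition accessible (f : fsharp) (i : nat) : Prop :=
  exists a, onth (ty_args (fsty f)) i = Some a /\ ge_plus (ty_sort (fsty f)) a.

Definition red_acc (I : mterm -> Prop) (s t : mterm) : Prop :=
  exists f ss i u ts k k',
    s = apps (Fun f) ss /\ term_of s (Base k) /\
    accessible f i /\ onth ss i = Some u /\
    t = apps u ts /\ term_of t (Base k') /\ Forall (computable I) ts.

(* The defining property of the set [C_S]. *)
Definition is_CS (S : rule_set) (C : mterm -> Prop) : Prop :=
  rc_set S C /\
  forall s, C s <->
    exists k, term_of s (Base k) /\
      sn (fun u v => red S u v \/ red_acc C u v) s /\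
      forall f ss i u, reds S s (apps (Fun f) ss) ->
        accessible f i -> onth ss i = Some u -> computable C u.

(* [C] is the set [C_S]. *)
Definition computable_chain (S : rule_set) (C : mterm -> Prop) (R : rule_set)
    (rho : nat -> label) (s t : nat -> mterm) : Prop :=
  (forall u v, is_term u -> red R u v -> red S u v) /\
  forall i, exists r g, rho i = Pair r /\ wf_subst g /\
    s i = msubst g (dpl r) /\ t i = msubst g (dpr r) /\
    forall B v xs, beta_sub B (dpr r) v -> respects g B ->
      uniq xs -> xs =i fv v ->
      computable C (msubst g (foldr abs v xs)).

Inductive mode : Type :=
| Minimal
| Arbitrary
| Computable of rule_set.

Inductive form : Type :=
| Formative
| All.

Record dp_problem := DPProblem {
  pairs : dp -> Prop;
  rules : rule_set;
  pmode : mode;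
  pform : form
}.

Definition finite (CS : rule_set -> mterm -> Prop) (M : dp_problem) : Prop :=
  ~ exists rho s t,
      chain (pairs M) (rules M) rho s t /\
      match pmode M with
      | Minimal => minimal_chain (rules M) t
      | Arbitrary => True
      | Computable Q => computable_chain Q (CS Q) (rules M) rho s t
      end /\
      match pform M with
      | Formative => formative_chain (rules M) rho s t
      | All => True
      end.

Definition infinite (CS : rule_set -> mterm -> Prop) (M : dp_problem) : Prop :=
  ~ finite CS M \/ ~ terminating (rules M).

(* [None] stands for NO. *)
Definition processor := dp_problem -> option (dp_problem -> Prop).

Definition sound (CS : rule_set -> mterm -> Prop) (proc : processor) : Prop :=
  forall M Ms, proc M = Some Ms -> (forall N, Ms N -> finite CS N) ->
    finite CS M.

Definition complete (CS : rule_set -> mterm -> Prop) (proc : processor) :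
    Prop :=
  forall M,
    match proc M with
    | None => True
    | Some Ms => exists N, Ms N /\ infinite CS N
    end -> infinite CS M.

Definition maps_vars_to_vars (g : substitution) : Prop :=
  forall x, exists y, sv g x = Var y.

(* For elements of the set of dependency pairs of a problem with rules [R]. *)
Definition dependency_edge (R : rule_set) (r1 r2 : dp) : Prop :=
  (exists Z ss ts, dpr r1 = apps (Meta Z ss) ts) \/
  (exists f ss us g d,
     dpr r1 = apps (Fun f) ss /\ dpl r2 = apps (Fun f) us /\
     wf_subst g /\ wf_subst d /\
     respects g (dpc r1) /\ respects d (dpc r2) /\
     maps_vars_to_vars g /\ maps_vars_to_vars d /\
     Forall2 (reds R) (map (msubst g) ss) (map (msubst d) us)).

Record approximation (M : dp_problem) := Approximation {
  node : finType;
  edge : rel node;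
  theta : forall r, pairs M r -> node;
  theta_edge : forall r1 r2 (h1 : pairs M r1) (h2 : pairs M r2),
    dependency_edge (rules M) r1 r2 -> edge (theta h1) (theta h2)
}.

(* Strongly connected components.  With [nontrivial = false] these are the
   classes of mutual reachability; [nontrivial = true] leaves out the singletons
   without a self-loop, as is often done for dependency graphs. *)
Definition is_scc (nontrivial : bool) (V : finType) (e : rel V)
    (C : {set V}) : Prop :=
  (exists v, C = [set w | connect e v w && connect e w v]) /\
  (nontrivial -> exists v w, v \in C /\ w \in C /\ e v w).

Definition restrict (M : dp_problem) (G : approximation M)
    (C : {set node G}) : dp_problem :=
  DPProblem (fun r => exists h : pairs M r, theta G h \in C)
    (rules M) (pmode M) (pform M).

Definition graph_processor (nontrivial : bool)
    (G : forall M, approximation M) : processor :=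
  fun M => Some (fun N => exists C : {set node (G M)},
    is_scc nontrivial (@edge M (G M)) C /\ N = restrict C).

End Framework.

(* Main.v *)
(** Completeness holds because a chain over fewer pairs is a chain over all pairs.
For soundness, consecutive dependency pairs of a chain are joined by an edge:
after a non-collapsing pair the next term is headed by a function symbol, so no
beta step can intervene.  If the pairs occur infinitely often, the finite graph
has a node visited infinitely often, and after its first visit the walk stays in
the strongly connected component of that node; the corresponding tail of the
chain is a chain of that component.  A chain cannot end in beta steps only:
on simply typed terms, beta contraction at the head combined with the passage to
subterms is terminating, by a Tait-style computability argument. *)

From Stdlib Require Import List Relations Wellfounded Classical.
Require Import Defs.
From mathcomp Require Import all_boot.

Set Implicit Arguments.
Unset Strict Implicit.
Unset Printing Implicit Defensive.

(** * The graph *)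

(** Otherwise each node has a bound beyond which it is never visited, and the maximum of these
    finitely many bounds contradicts the hypothesis. *)
Lemma infinitely_often_node (V : finType) (visits : nat -> V -> Prop) :
  (forall n, exists k v, n <= k /\ visits k v) ->
  exists v, forall n, exists2 k, n <= k & visits k v.
Proof.
move=> inf; apply: NNPP => no.
have /fin_all_exists [f fP] :
    forall v, exists n, forall k, n <= k -> ~ visits k v.
  move=> v; apply: NNPP => nv; apply: no; exists v => n.
  apply: NNPP => nk; apply: nv; exists n => k le_nk vis.
  by apply: nk; exists k.
have [k [v [le_k vis]]] := inf (\max_v f v).
by apply: (fP v k _ vis); apply: leq_trans le_k; apply: leq_bigmax.
Qed.

Section Walk.

(** [visits] is a relation because some times, those of beta steps, visit no node; edges are
    demanded only between consecutive visits. *)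
Variables (V : finType) (e : rel V) (visits : nat -> V -> Prop).
Hypothesis walk_edge : forall i j v w, i < j -> visits i v -> visits j w ->
  (forall k u, i < k -> k < j -> ~ visits k u) -> e v w.

(** Induction on the length [j - i], cutting the walk at an intermediate visit when there is one. *)
Lemma walk_connect i j v w : i < j -> visits i v -> visits j w -> connect e v w.
Proof.
have [n] := ubnP (j - i); elim: n i j v w => // n IH i j v w lt_n lt_ij vi wj.
have [[k [u [ik kj uk]]]|no] :=
    classic (exists k u, [/\ i < k, k < j & visits k u]).
  rewrite ltnS in lt_n; apply: (@connect_trans _ _ u).
    by apply: (IH i k) => //; apply: leq_trans lt_n; apply: ltn_sub2r.
  by apply: (IH k j) => //; apply: leq_trans lt_n; apply: ltn_sub2l.
apply: connect1; apply: (walk_edge lt_ij vi wj) => k u ik kj uk.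
by apply: no; exists k, u.
Qed.

Lemma walk_stays_in_scc (nontrivial : bool) :
  (forall n, exists k v, n <= k /\ visits k v) ->
  exists N (C : {set V}), is_scc nontrivial e C /\
    forall k v, N <= k -> visits k v -> v \in C.
Proof.
move=> inf; have [v vP] := infinitely_often_node inf.
have [N _ vN] := vP 0.
pose C := [set w | connect e v w && connect e w v].
(* [w] is reached from the visit of [v] at time [N], and reaches [v] again because [v] recurs after
   time [k]. *)
have inC k w : N < k -> visits k w -> w \in C.
  move=> Nk wk; have [l kl vl] := vP k.+1.
  by rewrite inE (walk_connect Nk vN wk) (walk_connect kl wk vl).
exists N.+1, C; split; last exact: inC.
split; first by exists v.
move=> _.
(* The first visit after time [N] directly follows that of [v], so it gives the edge inside [C] that
   a nontrivial component must have. *)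
have ex : exists k, N < k /\ exists w, visits k w.
  by have [k [w [Nk wk]]] := inf N.+1; exists k; split=> //; exists w.
have [k [[Nk [w wk]] kmin]] : exists k, (N < k /\ exists w, visits k w) /\
    forall l, (N < l /\ exists w, visits l w) -> k <= l.
  case: ex => k; have [n] := ubnP k; elim: n k => // n IH k lt_kn Pk.
  have [[l [Pl lt_lk]]|no] :=
      classic (exists l, (N < l /\ exists w, visits l w) /\ l < k).
    by apply: (IH l) => //; apply: leq_trans lt_lk _.
  exists k; split=> // l Pl; rewrite leqNgt; apply/negP => lt_lk.
  by apply: no; exists l.
exists v, w; split; first by rewrite inE connect0.
split; first exact: inC wk.
apply: (walk_edge Nk vN wk) => l u Nl lk ul.
by have := kmin l (conj Nl (ex_intro _ u ul)); rewrite leqNgt lk.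
Qed.

End Walk.

Section Terms.

Variable sg : signature.
Local Notation mterm := (mterm sg).
Implicit Types (s t u v : mterm) (th : nat -> mterm) (xi : nat -> nat).

(** * Applications and substitutions *)

Section NestedInduction.

Variable P : mterm -> Prop.
Hypotheses (HB : forall i, P (Bound sg i)) (HV : forall x, P (Var x))
  (HF : forall f, P (Fun f)) (HA : forall u v, P u -> P v -> P (App u v))
  (HL : forall a u, P u -> P (Lam a u))
  (HM : forall Z ts, Forall P ts -> P (Meta Z ts)).

(** The generated principle gives no hypothesis for the argument list of [Meta]. *)
Fixpoint mterm_nested_ind s : P s :=
  match s with
  | Bound i => HB i
  | Var x => HV x
  | Fun f => HF f
  | App u v => HA (mterm_nested_ind u) (mterm_nested_ind v)
  | Lam a u => HL a (mterm_nested_ind u)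
  | Meta Z ts => HM Z
      ((fix all_P us : Forall P us :=
         match us with
         | nil => Forall_nil P
         | u :: us' => Forall_cons u (mterm_nested_ind u) (all_P us')
         end) ts)
  end.

End NestedInduction.

Lemma mhead_apps s ts : mhead (apps s ts) = mhead s.
Proof. by elim: ts s => //= t ts IH s; rewrite IH. Qed.

Lemma spine_args_apps s ts : spine_args (apps s ts) = spine_args s ++ ts.
Proof.
by elim: ts s => [|t ts IH] s; rewrite /= ?cats0 // IH /= cat_rcons.
Qed.

Lemma apps_rcons s ts t : apps s (rcons ts t) = App (apps s ts) t.
Proof. by rewrite /apps foldl_rcons. Qed.

Lemma apps_mhead s : apps (mhead s) (spine_args s) = s.
Proof. by elim: s => //= u IH v _; rewrite apps_rcons IH. Qed.

Lemma apps_redex_inj a u v ws a' u' v' ws' :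
  apps (App (@Lam sg a u) v) ws = apps (App (Lam a' u') v') ws' ->
  [/\ a = a', u = u', v = v' & ws = ws'].
Proof.
move=> eq; have /= := congr1 (@mhead sg) eq; rewrite !mhead_apps => -[<- <-].
have := congr1 (@spine_args sg) eq.
by rewrite !spine_args_apps => -[<- <-].
Qed.

Lemma apps_Fun_inj (f f' : fsharp sg) ts ts' :
  apps (Fun f) ts = apps (Fun f') ts' -> f = f' /\ ts = ts'.
Proof.
move=> eq; have := congr1 (@mhead sg) eq; rewrite !mhead_apps => -[<-].
by have := congr1 (@spine_args sg) eq; rewrite !spine_args_apps.
Qed.

Lemma msubst_apps (g : substitution sg) s ts :
  msubst g (apps s ts) = apps (msubst g s) (map (msubst g) ts).
Proof. by elim: ts s => //= t ts IH s; rewrite IH. Qed.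

Lemma vsubst_apps xs us s ts :
  vsubst xs us (apps s ts) = apps (vsubst xs us s) (map (vsubst xs us) ts).
Proof. by elim: ts s => //= t ts IH s; rewrite IH. Qed.

Lemma map_Forall (f g : mterm -> mterm) ts :
  Forall (fun t => f t = g t) ts -> map f ts = map g ts.
Proof. by elim=> //= t us -> _ ->. Qed.

Lemma msubst_eq_fv (g h : substitution sg) s : sm g = sm h ->
  {in fv s, sv g =1 sv h} -> msubst g s = msubst h s.
Proof.
move=> eq_m; elim/mterm_nested_ind: s => //=.
- by move=> x -> //; rewrite inE.
- move=> u v IHu IHv eq_v; rewrite IHu ?IHv // => x xi;
  by apply: eq_v; rewrite mem_cat xi ?orbT.
- by move=> a u IH /IH ->.
move=> Z ts IH eq_v; rewrite eq_m; congr inst.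
elim: IH eq_v => //= t us IHt _ IHus eq_v.
rewrite IHt ?IHus // => x xi; by apply: eq_v; rewrite mem_cat xi ?orbT.
Qed.

(** * Renaming and instantiation of de Bruijn indices *)

Lemma rename_ext xi xi' s : xi =1 xi' -> rename xi s = rename xi' s.
Proof.
elim/mterm_nested_ind: s xi xi' => //= [i|u v IHu IHv|a u IH|Z ts IH] xi xi' eq.
- by rewrite eq.
- by rewrite (IHu _ xi') ?(IHv _ xi').
- by rewrite (IH _ (up_ren xi')) // => -[|i] //=; rewrite eq.
by congr Meta; apply: map_Forall; apply: Forall_impl IH => t; apply.
Qed.

Lemma binst_ext th th' s : th =1 th' -> binst th s = binst th' s.
Proof.
elim/mterm_nested_ind: s th th' => //= [u v IHu IHv|a u IH|Z ts IH] th th' eq.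
- by rewrite (IHu _ th') ?(IHv _ th').
- by rewrite (IH _ (up_inst th')) // => -[|i] //=; rewrite eq.
by congr Meta; apply: map_Forall; apply: Forall_impl IH => t; apply.
Qed.

Lemma rename_rename xi xi' s :
  rename xi (rename xi' s) = rename (xi \o xi') s.
Proof.
elim/mterm_nested_ind: s xi xi' => //= [u v IHu IHv|a u IH|Z ts IH] xi xi'.
- by rewrite IHu IHv.
- by rewrite IH; congr Lam; apply: rename_ext => -[].
rewrite -map_comp; congr Meta; apply: map_Forall.
by apply: Forall_impl IH => t; apply.
Qed.

Lemma binst_rename th xi s : binst th (rename xi s) = binst (th \o xi) s.
Proof.
elim/mterm_nested_ind: s th xi => //= [u v IHu IHv|a u IH|Z ts IH] th xi.
- by rewrite IHu IHv.
- by rewrite IH; congr Lam; apply: binst_ext => -[].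
rewrite -map_comp; congr Meta; apply: map_Forall.
by apply: Forall_impl IH => t; apply.
Qed.

Lemma rename_binst th xi s :
  rename xi (binst th s) = binst (rename xi \o th) s.
Proof.
elim/mterm_nested_ind: s th xi => //= [u v IHu IHv|a u IH|Z ts IH] th xi.
- by rewrite IHu IHv.
- rewrite IH; congr Lam; apply: binst_ext => -[|i] //=.
  by rewrite !rename_rename.
rewrite -map_comp; congr Meta; apply: map_Forall.
by apply: Forall_impl IH => t; apply.
Qed.

(** Below a binder [up_inst] renames, so this law rests on both mixed laws with renamings. *)
Lemma binst_binst th th' s :
  binst th (binst th' s) = binst (binst th \o th') s.
Proof.
elim/mterm_nested_ind: s th th' => //= [u v IHu IHv|a u IH|Z ts IH] th th'.
- by rewrite IHu IHv.
- rewrite IH; congr Lam; apply: binst_ext => -[|i] //=.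
  by rewrite binst_rename rename_binst.
rewrite -map_comp; congr Meta; apply: map_Forall.
by apply: Forall_impl IH => t; apply.
Qed.

Lemma binst_Bound s : binst (@Bound sg) s = s.
Proof.
elim/mterm_nested_ind: s => //= [u v -> ->|a u IH|Z ts IH] //.
  by rewrite -[in RHS]IH; congr Lam; apply: binst_ext => -[].
by rewrite -[in RHS](map_id ts); congr Meta; apply: map_Forall.
Qed.

Definition scons t th (i : nat) : mterm := if i is j.+1 then th j else t.

Lemma inst1E u v : inst u [:: v] = binst (scons v (@Bound sg)) u.
Proof. by apply: binst_ext => -[|i] //=; rewrite nth_nil subn1. Qed.

Lemma inst_binst_up th u v :
  inst (binst (up_inst th) u) [:: v] = binst (scons v th) u.
Proof.
rewrite inst1E binst_binst; apply: binst_ext => -[|i] //=.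
by rewrite binst_rename binst_Bound.
Qed.

(** A semantic form of having no dangling index, which rewrites directly under every
    instantiation. *)
Definition locally_closed v : Prop := forall th, binst th v = v.

Lemma locally_closed_rename v xi : locally_closed v -> rename xi v = v.
Proof.
move=> lc; rewrite -{2}(lc (@Bound sg \o xi)) -binst_rename.
by rewrite binst_Bound.
Qed.

Lemma term_locally_closed G v a th : has_type G v a -> fmv v = [::] ->
  (forall i b, onth G i = Some b -> th i = Bound sg i) -> binst th v = v.
Proof.
move=> ty_v; elim: ty_v th => //=.
- by move=> {}G i b onth_i th _ /(_ _ _ onth_i).
- move=> {}G s t b c _ IHs _ IHt th /eqP.
  rewrite -size_eq0 size_cat addn_eq0 !size_eq0 => /andP[/eqP ms /eqP mt] thP.
  by rewrite IHs ?IHt.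
move=> {}G b s c _ IH th ms thP; rewrite IH // => -[|i] d //= /thP ->.
by [].
Qed.

Lemma vsubst_rename x v xi s : locally_closed v ->
  vsubst [:: x] [:: v] (rename xi s) = rename xi (vsubst [:: x] [:: v] s).
Proof.
move=> lc; elim/mterm_nested_ind: s xi => //= [y|u w IHu IHw|a u IH|Z ts IH] xi.
- by case: eqP => //= _; rewrite locally_closed_rename.
- by rewrite IHu IHw.
- by rewrite IH.
rewrite -!map_comp; congr Meta; apply: map_Forall.
by apply: Forall_impl IH => t; apply.
Qed.

Lemma vsubst_binst x v th s : locally_closed v ->
  vsubst [:: x] [:: v] (binst th s) =
  binst (vsubst [:: x] [:: v] \o th) (vsubst [:: x] [:: v] s).
Proof.
move=> lc; elim/mterm_nested_ind: s th => //= [y|u w IHu IHw|a u IH|Z ts IH] th.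
- by case: eqP => //= _; rewrite lc.
- by rewrite IHu IHw.
- rewrite IH; congr Lam; apply: binst_ext => -[|i] //=.
  by rewrite vsubst_rename.
rewrite -!map_comp; congr Meta; apply: map_Forall.
by apply: Forall_impl IH => t; apply.
Qed.

Lemma vsubst_notin x v s : x \notin fv s -> vsubst [:: x] [:: v] s = s.
Proof.
elim/mterm_nested_ind: s => //= [y|u w IHu IHw|a u IH|Z ts IH].
- by rewrite inE => /negbTE ->.
- by rewrite mem_cat negb_or => /andP[/IHu-> /IHw->].
- by move=> /IH->.
move=> nx; congr Meta; elim: IH nx => //= t us IHt _ IHus.
by rewrite mem_cat negb_or => /andP[/IHt-> /IHus->].
Qed.

(** Reconciles two treatments of binders: subterms are reached by opening with a name, contraction
    instantiates the index. *)
Lemma vsubst_open x v u : locally_closed v -> x \notin fv u ->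
  vsubst [:: x] [:: v] (open u x) = inst u [:: v].
Proof.
move=> lc nx; rewrite /open !inst1E vsubst_binst // vsubst_notin //.
by apply: binst_ext => -[|i] //=; rewrite eqxx.
Qed.

Lemma vsubst_open_neq x v u z : locally_closed v -> z != x ->
  vsubst [:: x] [:: v] (open u z) = open (vsubst [:: x] [:: v] u) z.
Proof.
move=> lc zx; rewrite /open !inst1E vsubst_binst //.
by apply: binst_ext => -[|i] //=; rewrite eq_sym (negbTE zx).
Qed.

(** * Termination of head contraction with subterms *)

(** [hs_lam] puts no freshness condition on [x], so that steps below binders survive substitution
    without side conditions. *)
Inductive head_sub_step : mterm -> mterm -> Prop :=
| hs_beta a u v ws :
    head_sub_step (apps (App (Lam a u) v) ws) (apps (inst u [:: v]) ws)
| hs_appl s t : head_sub_step (App s t) s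
| hs_appr s t : head_sub_step (App s t) t
| hs_lam a u x : vty x = a -> head_sub_step (Lam a u) (open u x).

Local Notation snh := (sn head_sub_step).

Lemma snh_step s t : snh s -> head_sub_step s t -> snh t.
Proof. by case=> H /H. Qed.

Lemma snh_app s t : snh s -> snh t ->
  (forall a u v ws, App s t = apps (App (Lam a u) v) ws ->
     snh (apps (inst u [:: v]) ws)) ->
  snh (App s t).
Proof.
move=> sns snt red; constructor => r; move eq_w: (App s t) => w st; case: w r / st eq_w.
- by move=> a u v ws /red.
- by move=> s' t' [<- _].
- by move=> s' t' [_ <-].
- by [].
Qed.

Inductive neutral : mterm -> Prop :=
| neutral_symbol s : is_symbol s -> neutral s
| neutral_app s t : neutral s -> snh t -> neutral (App s t).

Lemma neutral_mhead s : neutral s -> is_symbol (mhead s).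
Proof. by elim=> {s} //; case. Qed.

Lemma neutral_snh s : neutral s -> snh s.
Proof.
elim=> {s} [s sym|s t ne IH snt].
  constructor => r st; case: s r / st sym => [a u v ws|s t|s t|a u x _].
  - by have := mhead_apps (App (Lam a u) v) ws; case: (apps _ _).
  - by [].
  - by [].
  - by [].
apply: snh_app => [//|//|a u v ws eq].
have := neutral_mhead ne; rewrite -[mhead s]/(mhead (App s t)) eq mhead_apps.
by [].
Qed.

(** Only the head redex is contracted, so no induction on reductions inside [u] or [v] arises; the
    remaining steps lead to subterms. *)
Lemma snh_redex a u v ws : (forall x, vty x = a -> snh (open u x)) -> snh v ->
  snh (apps (inst u [:: v]) ws) -> snh (apps (App (Lam a u) v) ws).
Proof.
move=> snu snv; elim/last_ind: ws => [|ws w IH] sn_inst.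
  apply: snh_app => [|//|a' u' v' ws' eq].
    constructor => r; move eq_w: (Lam a u) => w st.
    case: w r / st eq_w => [b u' v' ws eq|s t|s t|b u' x ty_x [eq_a <-]].
    - by have := congr1 (@spine_args sg) eq; rewrite spine_args_apps.
    - by [].
    - by [].
    - by apply: snu; rewrite eq_a.
  have [_ <- <- <-] := @apps_redex_inj a u v [::] a' u' v' ws' eq.
  exact: sn_inst.
move: (sn_inst); rewrite !apps_rcons => sn_app.
apply: snh_app.
(* The contractum with one argument less is the function part of the given contractum. *)
- by apply: IH; apply: snh_step sn_app _; constructor.
- by apply: snh_step sn_app _; constructor.
move=> a' u' v' ws'; rewrite -apps_rcons => /apps_redex_inj[_ <- <- <-].
exact: sn_inst.
Qed.

(** Tait's computability predicate for [head_sub_step]. *)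
Fixpoint comp (a : ty (bsort sg)) s : Prop :=
  match a with
  | Base _ => snh s
  | Arr b c => forall t, comp b t -> comp c (App s t)
  end.

(* Since [comp] does not require its argument to be typable, the dangling index
   [Bound 0] can serve as a variable of every type. *)
Lemma comp_candidate a :
  (forall s, comp a s -> snh s) /\ (forall s, neutral s -> comp a s).
Proof.
elim: a => [k|b [snb neb] c [snc nec]] /=; first by split=> [//|s /neutral_snh].
split=> s Hs.
  have := snc _ (Hs (Bound sg 0) (neb _ _)) => /(_ (neutral_symbol _)).
  by move=> /(_ isT) /snh_step; apply; constructor.
by move=> t /snb snt; apply: nec; constructor.
Qed.

(** At an arrow type a further argument extends the spine at its end, so the redex stays at the
    head. *)
Lemma comp_redex a u v b ws : (forall x, vty x = a -> snh (open u x)) -> snh v ->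
  comp b (apps (inst u [:: v]) ws) -> comp b (apps (App (Lam a u) v) ws).
Proof.
move=> snu snv; elim: b ws => [k|b _ c IHc] ws /=; first exact: snh_redex.
by move=> Hc t /Hc; rewrite -!apps_rcons; apply: IHc.
Qed.

(** The fundamental lemma: only dangling indices need computable values, since free variables and
    function symbols are neutral. *)
Lemma typed_comp G s b th : has_type G s b -> fmv s = [::] ->
  (forall i a, onth G i = Some a -> comp a (th i)) -> comp b (binst th s).
Proof.
move=> ty_s; elim: ty_s th => {G s b} /=.
- by move=> G i a onth_i th _; apply.
- by move=> G x th _ _; apply: (proj2 (comp_candidate _)); constructor.
- by move=> G f th _ _; apply: (proj2 (comp_candidate _)); constructor.
- move=> G s t b c _ IHs _ IHt th /eqP.
  rewrite -size_eq0 size_cat addn_eq0 !size_eq0 => /andP[/eqP ms /eqP mt] thP.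
  by apply: (IHs th ms thP); apply: IHt.
- move=> G a s b _ IH th ms thP t ct.
  have body w : comp a w -> comp b (inst (binst (up_inst th) s) [:: w]).
    by move=> cw; rewrite inst_binst_up; apply: IH => // -[|i] c /= => [[<-]|/thP].
  apply: (@comp_redex a _ t b [::]); last exact: body.
    (* Opening with [x] is the case of [body] for the computable term [Var x]. *)
    move=> x _; apply: (proj1 (comp_candidate b)); apply: body.
    by apply: (proj2 (comp_candidate a)); constructor.
  exact: (proj1 (comp_candidate a)).
by [].
Qed.

Lemma term_snh s : is_term s -> snh s.
Proof.
move=> [a [ty_s ms]]; apply: (proj1 (comp_candidate a)).
by rewrite -(binst_Bound s); apply: (typed_comp ty_s ms) => -[].
Qed.

Lemma term_redex_locally_closed a u v :
  is_term (App (Lam a u) v) -> locally_closed v.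
Proof.
move=> [b [ty_s /eqP]] /=.
rewrite -size_eq0 size_cat addn_eq0 !size_eq0 => /andP[_ /eqP mv] th.
inversion ty_s; subst.
by apply: (term_locally_closed _ mv); [eassumption | case].
Qed.

(** * Beta steps of a chain as head contractions *)

Local Notation head_subs := (clos_refl_trans mterm head_sub_step).

Scheme subterm_mut := Induction for subterm Sort Prop
with strict_subterm_mut := Induction for strict_subterm Sort Prop.

(** The names opened along the way avoid [A], hence differ from [x], so substituting for [x]
    commutes with the descent. *)
Lemma subterm_head_subs A x v s q : locally_closed v -> x \in A ->
  subterm A s q ->
  head_subs (vsubst [:: x] [:: v] s) (vsubst [:: x] [:: v] q).
Proof.
move=> lc xA.
apply: (@subterm_mut sg A
  (fun s q _ => head_subs (vsubst [:: x] [:: v] s) (vsubst [:: x] [:: v] q))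
  (fun s q _ => head_subs (vsubst [:: x] [:: v] s) (vsubst [:: x] [:: v] q)))
  => {s q} //=.
- by move=> s; apply: rt_refl.
- by move=> u w t _; apply: rt_trans; apply: rt_step; constructor.
- by move=> u w t _; apply: rt_trans; apply: rt_step; constructor.
move=> a u z t ty_z _ zA _.
rewrite vsubst_open_neq //; last by apply: contraNneq zA => ->.
by apply: rt_trans; apply: rt_step; constructor.
Qed.

Lemma sharp_cases s : sharp s = s \/ exists g ts, sharp s = apps (Fun (Marked g)) ts.
Proof.
rewrite /sharp; case: (mhead s) => [i|x|[f|f]|u v|a u|Z ts]; try by left.
case: ifP => _; last by left.
by case: insubP => [g _ _|_]; [right; exists g, (spine_args s) | left].
Qed.

Lemma beta_step_mhead s t : beta_step s t -> exists a u, mhead s = Lam a u.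
Proof. by move=> [a [u [v [ws [-> _]]]]]; rewrite mhead_apps; exists a, u. Qed.

Lemma clos_trans_rt (A : Type) (R : relation A) x y z :
  clos_trans A R x y -> clos_refl_trans A R y z -> clos_trans A R x z.
Proof.
move=> xy yz; elim: yz x xy => {y z} [y z yz|//|y z w _ IHyz _ IHzw] x xy.
  by apply: t_trans xy _; apply: t_step.
by apply: IHzw; apply: IHyz.
Qed.

(** When [t] is a substituted subterm of the body, it is also reached by contracting first and then
    descending. The head of [t] rules out that it was marked. *)
Lemma beta_step_head_sub s t a u : is_term s -> beta_step s t ->
  mhead t = Lam a u -> clos_trans _ head_sub_step s t.
Proof.
move=> term_s [b [w [v [ws [eq_s [[_ ->] _|[ws0 [x [q]]]]]]]]].
  by rewrite eq_s; apply: t_step; constructor.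
move=> [ty_x [nx [sub [_ [_ ->]]]]].
move: eq_s term_s; rewrite {}ws0 /= => -> /term_redex_locally_closed lc.
have [-> _|[g [ts ->]]] := sharp_cases q; last by rewrite vsubst_apps mhead_apps.
have := subterm_head_subs lc (mem_head _ _) sub; rewrite vsubst_open //.
apply: clos_trans_rt; apply: t_step.
exact: (hs_beta b w v [::]).
Qed.

(** Reducing arguments between steps requires a function symbol at the head. *)
Lemma chain_link_redex (R : rule_set sg) s t a u :
  mhead s = Lam a u -> chain_link R t s -> t = s.
Proof.
by move=> eq_s [//|[f [us [ws [_ [eq _]]]]]]; move: eq_s; rewrite eq mhead_apps.
Qed.

Lemma sn_no_sequence (R : mterm -> mterm -> Prop) (s : nat -> mterm) :
  sn R (s 0) -> ~ forall i, R (s i) (s i.+1).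
Proof.
move eq_s0: (s 0) => s0 sn_s0; elim: sn_s0 s eq_s0 => {s0} s0 _ IH s eq_s0 step.
by apply: (IH (s 1) _ (fun i => s i.+1)) => //; rewrite -eq_s0.
Qed.

Lemma no_beta_tail (R : rule_set sg) (s t : nat -> mterm) N :
  (forall i, is_term (s i)) ->
  (forall i, N <= i -> beta_step (s i) (t i)) ->
  (forall i, chain_link R (t i) (s i.+1)) -> False.
Proof.
move=> term_s beta link.
have step i : N <= i -> clos_trans _ head_sub_step (s i) (s i.+1).
  move=> Ni; have [a [u eq_s]] := beta_step_mhead (beta _ (leqW Ni)).
  have eq_t := chain_link_redex eq_s (link i).
  by rewrite -eq_t; apply: beta_step_head_sub (beta _ Ni) _; rewrite // eq_t eq_s.
(* [sn] reverses its relation, so the closure of the converse has to be turned into the converse of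
   the closure. *)
have acc : sn (clos_trans _ head_sub_step) (s N).
  have := Acc_clos_trans _ _ _ (term_snh (term_s N)).
  elim=> x _ IH; constructor => y xy; apply: IH; elim: xy => [v w|v w z _ + _].
    by move=> vw; apply: t_step.
  by move=> wv zw; apply: t_trans zw wv.
have := @sn_no_sequence (clos_trans _ head_sub_step) (fun i => s (N + i)).
rewrite addn0 => /(_ acc); apply.
by move=> i; rewrite addnS; apply: step; rewrite leq_addr.
Qed.

(** * Edges between consecutive pairs *)

Lemma mhead_not_app s : ~~ is_app (mhead s).
Proof. by elim: s. Qed.

Lemma Forall2_refl (T : Type) (R : T -> T -> Prop) (ts : seq T) :
  (forall x, R x x) -> Forall2 R ts ts.
Proof. by move=> refl; elim: ts => [|t ts IH]; constructor. Qed.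

(** A dependency edge asks that all variables go to variables, but a chain step ensures this only on
    those of the right-hand side; elsewhere the identity is taken. *)
Definition restrict_vars (xs : seq (var sg)) (g : substitution sg) :=
  Substitution (fun x => if x \in xs then sv g x else Var x) (sm g).

Lemma wf_restrict_vars xs g : wf_subst g -> wf_subst (restrict_vars xs g).
Proof.
move=> [wf_v wf_m]; split=> // x /=; case: ifP => // _.
by split; first exact: T_Var.
Qed.

(** In the second case the step instantiates the right-hand side with variables for variables, which
    keeps a symbol at the head. *)
Lemma dp_step_mhead (r : dp sg) s t : dp_step r s t ->
  (exists Z ts us, dpr r = apps (Meta Z ts) us) \/
  is_symbol (mhead t) /\
  forall f, mhead t = Fun f ->
    exists ss g, [/\ dpr r = apps (Fun f) ss, wf_subst g, respects g (dpc r),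
      maps_vars_to_vars g & t = apps (Fun f) (map (msubst g) ss)].
Proof.
move=> [g [wf_g [[fresh_g _] [resp_g [_ tE]]]]].
have [_ [_ [_ [_ [_ no_redex]]]]] := dpP r.
have [|no_meta] := classic (exists Z ts us, dpr r = apps (Meta Z ts) us).
  by left.
right.
have {tE} [pP tE] : ((exists u v, dpr r = App u v) \/
    exists f, dpr r = Fun (Marked f)) /\ t = msubst g (dpr r).
  case: tE => [//|[Z [us [xs [v [pE _]]]]]].
  by case: no_meta; exists Z, us, [::].
pose g' := restrict_vars (fv (dpr r)) g.
have {tE} tE : t = msubst g' (dpr r).
  by rewrite tE; apply: msubst_eq_fv => //= x ->.
have g'_vars : maps_vars_to_vars g'.
  by move=> x /=; case: ifP => [/fresh_g[y [? _]]|_]; [exists y | exists x].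
have pE := esym (apps_mhead (dpr r)).
move: (spine_args _) pE => ss pE.
have tE' : mhead t = mhead (msubst g' (mhead (dpr r))).
  by rewrite tE {1}pE msubst_apps mhead_apps.
case hE: (mhead (dpr r)) => [i|x|f|u v|a u|Z zs]; rewrite hE in pE tE'.
- by rewrite tE'.
- by have [y yE] := g'_vars x; rewrite tE' [msubst _ _]yE.
- rewrite tE'; split=> // _ [<-]; exists ss, g'; split=> //.
    exact: wf_restrict_vars.
  by rewrite tE pE msubst_apps.
- by have := mhead_not_app (dpr r); rewrite hE.
(* A bare abstraction is excluded by the form of the step, an applied one by [is_dp]. *)
- case: ss pE => [|v ws] pE.
    by case: pP => [[u' [v']]|[f]]; rewrite pE.
  by case: no_redex; exists a, u, v, ws.
by case: no_meta; exists Z, zs, ss.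
Qed.

(** The abstraction at the head of [s2] forces [r1] to be collapsing, and such a pair has edges to
    every [r2], however many beta steps intervene. *)
Lemma chain_edge_beta (R : rule_set sg) (r1 r2 : dp sg) s1 t1 s2 t2 :
  dp_step r1 s1 t1 -> chain_link R t1 s2 -> beta_step s2 t2 ->
  dependency_edge R r1 r2.
Proof.
move=> step1 link /beta_step_mhead[a [u s2E]]; left.
have t1E := chain_link_redex s2E link; rewrite -t1E in s2E.
by have [//|[]] := dp_step_mhead step1; rewrite s2E.
Qed.

Lemma chain_edge (R : rule_set sg) (r1 r2 : dp sg) s1 t1 s2 t2 :
  dp_step r1 s1 t1 -> chain_link R t1 s2 -> dp_step r2 s2 t2 ->
  dependency_edge R r1 r2.
Proof.
move=> step1 link [d [wf_d [_ [resp_d [s2E _]]]]].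
have [_ [_ [l2_closed [_ [[f [us [l2E _]]] _]]]]] := dpP r2.
have [|[_ t1P]] := dp_step_mhead step1; first by left.
(* The left-hand side is closed, so [d] may be reset to the identity on all variables. *)
pose d' := restrict_vars [::] d.
have {}s2E : s2 = apps (Fun f) (map (msubst d') us).
  rewrite -(msubst_apps d' (Fun f)) -l2E s2E.
  by apply: msubst_eq_fv => // x; rewrite l2_closed.
have [ts t1E reds_ts] :
    exists2 ts, t1 = apps (Fun f) ts & Forall2 (reds R) ts (map (msubst d') us).
  case: link => [->|[f' [ts [ws [-> [ws_eq ts_ws]]]]]].
    by exists (map (msubst d') us) => //; apply: Forall2_refl => x; apply: rt_refl.
  by move: ws_eq; rewrite s2E => /apps_Fun_inj[-> ->]; exists ts.
have [|ss [g [pE wf_g resp_g g_vars]]] := t1P f; first by rewrite t1E mhead_apps.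
rewrite t1E => /apps_Fun_inj[_ tsE].
right; exists f, ss, us, g, d'; rewrite -tsE.
do 3!split=> //; split; first exact: wf_restrict_vars.
by do 4!split=> //; move=> x; exists x.
Qed.

End Terms.

(** * Soundness and completeness of the graph processor *)

Theorem theorem4p6 (sg : signature)
  (CS : rule_set sg -> mterm sg -> Prop)
  (CS_spec : forall S : rule_set sg, is_CS S (CS S))
  (G : forall M : dp_problem sg, approximation M)
  (nontrivial : bool) :
  sound CS (graph_processor nontrivial G) /\
  complete CS (graph_processor nontrivial G).
Proof.
split=> M /=; last first.
  move=> [N [[C [_ ->]] [not_fin|non_term]]]; [left => fin | by right].
  apply: not_fin => -[rho [s [t [[term_st step next] mode]]]].
  apply: fin; exists rho, s, t; split=> //; split=> // i.
  by move: (step i); case: (rho i) => // r [[h _]].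
move=> Ms [<-] fin [rho [s [t [[term_st step next] [mode_ok form_ok]]]]].
pose visits i v := exists r (h : pairs M r), rho i = Pair r /\ theta (G M) h = v.
have inf n : exists k v, n <= k /\ visits k v.
  apply: NNPP => no.
  apply: (@no_beta_tail _ (rules M) s t n) => // i; first exact: (proj1 (term_st i)).
  move=> le_ni; move: (step i); case rho_i: (rho i) => [//|r] [h _].
  by case: no; exists i, (theta (G M) h); split=> //; exists r, h.
have edge_visits i j v w : i < j -> visits i v -> visits j w ->
    (forall k u, i < k -> k < j -> ~ visits k u) -> edge v w.
  move=> lt_ij [r1 [h1 [rho_i <-]]] [r2 [h2 [rho_j <-]]] none.
  apply: theta_edge.
  have := step i; have := step j; rewrite rho_i rho_j => -[_ step_j] [_ step_i].
  (* Either the two pairs are adjacent in the chain, or the step after the first is a beta step, no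
     visit lying in between. *)
  have [j_eq|j_neq] := eqVneq i.+1 j.
    by rewrite -j_eq in step_j; apply: chain_edge step_i (next i) step_j.
  have lt_i1j : i.+1 < j by rewrite ltn_neqAle j_neq.
  have := step i.+1; case rho_i1: (rho i.+1) => [|r].
    by move=> beta; apply: chain_edge_beta step_i (next i) beta.
  by move=> [h _]; case: (none i.+1 (theta (G M) h)) => //; exists r, h.
have [N [C [scc_C inC]]] := walk_stays_in_scc edge_visits nontrivial inf.
apply: (fin (restrict C)); first by exists C.
(* The conditions of all modes and of formativity are imposed index by index, so they pass to the
   tail starting at [N]. *)
exists (fun i => rho (N + i)), (fun i => s (N + i)), (fun i => t (N + i)).
split; [split=> [i|i|i] | split] => /=.
- exact: term_st.
- move: (step (N + i)); case rho_i: (rho (N + i)) => [//|r] [h dp_i]; split=> //.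
  by exists h; apply: (inC (N + i)); [apply: leq_addr | exists r, h].
- by rewrite addnS; apply: next.
- case: (pmode M) mode_ok => [min i|//|Q [red_incl comp_i]]; first exact: min.
  by split=> // i; apply: comp_i.
case: (pform M) form_ok => // form i r; rewrite addnS; exact: form.
Qed.
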